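(* Let $K$ be a Polish space and let $F\in B_1(K)$ be such that the range $F(K)$ is a discrete set. Then $F\in \mathrm{PS}(K)$.
   Context: $C(K)$ is the class of continuous functions $K\to\mathbb{R}$. $B_1(K)$ is the class of functions $f:K\to\mathbb{R}$ that are pointwise limits of sequences in $C(K)$. ''$F(K)$ is discrete'' means that no point of $F(K)$ is a cluster point of $F(K)$ (in $\mathbb{R}$). $\mathrm{PS}(K)$ is the set of all $f:K\to\mathbb{R}$ for which there is a sequence $(f_n)\subset C(K)$ such that for every $k\in K$ there is an integer $m$ with $f_n(k)=f(k)$ for all $n\ge m$. *)

(* Defs.v *)
From HB Require Import structures.
From mathcomp Require Import all_boot all_order all_algebra.
From mathcomp Require Import all_classical all_reals all_analysis.

Set Implicit Arguments.
Unset Strict Implicit.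
Unset Printing Implicit Defensive.

Import Order.TTheory GRing.Theory Num.Theory.
Import numFieldNormedType.Exports.

Local Open Scope classical_set_scope.
Local Open Scope ring_scope.

Definition is_metric (R : realType) (T : Type) (d : T -> T -> R) : Prop :=
  [/\ forall x, d x x = 0,
      forall x y, d x y = 0 -> x = y,
      forall x y, d x y = d y x &
      forall x y z, d x z <= d x y + d y z].

(* The metric is existentially quantified over a bare topological space, rather
   than taken from [completePseudoMetricType], because a Polish space carries
   no preferred metric and may be empty ([completeType] is pointed). *)
Definition completely_metrizable (R : realType) (K : topologicalType) : Prop :=
  exists d : K -> K -> R,
    [/\ is_metric d,
        forall x, nbhs x = filter_from [set e : R | 0 < e]
                             (fun e => [set y | d x y < e]) &
        forall u : nat -> K,
          (forall e, 0 < e -> \forall m & n \near \oo, d (u m) (u n) < e) ->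
          exists l : K, u @ \oo --> l].

Definition separable (K : topologicalType) : Prop :=
  exists2 D : set K, countable D & dense D.

Definition polish (R : realType) (K : topologicalType) : Prop :=
  separable K /\ completely_metrizable R K.

Definition B1 (R : realType) (K : topologicalType) : set (K -> R) :=
  [set f | exists2 f_ : nat -> K -> R,
     forall n, continuous (f_ n) &
     forall k, f_ n k @[n --> \oo] --> f k].

Definition PS (R : realType) (K : topologicalType) : set (K -> R) :=
  [set f | exists2 f_ : nat -> K -> R,
     forall n, continuous (f_ n) &
     forall k, \forall n \near \oo, f_ n k = f k].

(* Only points of [A] are required not to be cluster points of [A], so [A]
   need not be closed in [R]. *)
Definition discrete_subset (R : realType) (A : set R) : Prop :=
  forall y, A y -> ~ limit_point A y.

(* Main.v *)
Require Import Defs.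
From mathcomp Require Import all_boot all_order all_algebra.
From mathcomp Require Import all_classical all_reals all_analysis.
From mathcomp Require Import lra.

(** Fix continuous functions [f n] converging pointwise to [F].  For a rational
    [q], a radius [r = 1 / p.+1] and a rank [N], the set of the [k] with
    [`|f n k - q| <= r] for all [n >= N] is closed, and [F] sends it into the
    closed ball of centre [q] and radius [r].  Keep the sets for which that ball
    meets the range of [F] in at most one point: [F] is constant on each of
    them, they are countably many, and they cover [K] because every value of [F]
    is isolated in the range ([B1_discrete_cover]).

    Enumerate this cover as [C 0], [C 1], and so on.  On the closed set
    [D n], the union of the [C i] with [i < n], the function [F] is continuous
    and bounded.  Since [K] is metrizable, hence normal ([metrizable_normal]),
    Tietze's theorem gives a continuous function [g n] on the whole of [K] that
    agrees with [F] on [D n].  Each [k] lies in some [C i], hence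
    [g n k = F k] for all [n > i] ([closed_cover_PS]). *)

Import Order.TTheory GRing.Theory Num.Theory.
Import numFieldNormedType.Exports.

Local Open Scope classical_set_scope.
Local Open Scope ring_scope.

Lemma metrizable_normal {R : realType} {K : topologicalType} (d : K -> K -> R) :
  is_metric d ->
  (forall x, nbhs x = filter_from [set e : R | 0 < e]
                        (fun e => [set y | d x y < e])) ->
  normal_space K.
Proof.
move=> [d0 _ dC dT] nbhsd; apply/(@normal_openP R) => A B cA cB AB0.
have sep (D : set K) x : closed D -> ~ D x ->
    exists2 e : R, 0 < e & forall y, D y -> e <= d x y.
  move=> cD nDx; have : nbhs x (~` D).
    by apply: open_nbhs_nbhs; split => //; exact: closed_openC.
  rewrite nbhsd => -[e /= e0 eD]; exists e => // y Dy.
  by rewrite leNgt; apply/negP => /eD.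
(* The union of the open balls centred at a point of [D] and with radius at most
   half of the distance from that point to [E]. *)
pose U (D E : set K) := [set z | exists x e,
  [/\ D x, 0 < e, forall y, E y -> e <= d x y & d x z < e / 2]].
have oU D E : open (U D E).
  rewrite openE => z [x [e [Dx e0 Ee xz]]]; rewrite /interior nbhsd /=.
  exists (e / 2 - d x z) => /= [|t /= zt]; first by rewrite subr_gt0.
  by exists x, e; split => //; have := dT x z t; lra.
have subU D E : closed E -> D `&` E = set0 -> D `<=` U D E.
  move=> cE DE0 x Dx; have [|e e0 Ee] := sep E x cE.
    by move=> Ex; have : (D `&` E) x by []; rewrite DE0.
  by exists x, e; split => //; rewrite d0 divr_gt0.
exists (U A B), (U B A); split.
- exact: oU.
- exact: oU.
- exact: subU.
- by apply: subU => //; rewrite setIC.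
(* A common point [z] would give [d x y < e / 2 + e' / 2], although both [e]
   and [e'] are at most [d x y]. *)
- rewrite -subset0 => z [[x [e [Ax _ eB xz]]] [y [e' [By _ eA yz]]]].
  have := eB y By; have := eA x Ax; have := dT x z y.
  by rewrite (dC z y) (dC y x); lra.
Qed.

(** The sets [C n] may overlap and may be empty, so constancy of [F] on [C n] is
    expressed by comparing any two of its values there. *)
Lemma closed_cover_PS {R : realType} {K : topologicalType} (F : K -> R)
    (C : nat -> set K) :
  normal_space K -> (forall n, closed (C n)) ->
  (forall n x y, C n x -> C n y -> F x = F y) ->
  (forall x, exists n, C n x) -> PS F.
Proof.
move=> nK cC FC covC.
pose D n := \big[setU/set0]_(i < n) C i.
have cD n : closed (D n) by apply: closed_bigsetU.
have FcD n : {within D n, continuous F}.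
  elim: n => [|n IH]; first by rewrite /D big_ord0; exact: continuous_subspace0.
  rewrite /D big_ord_recr /=; apply: withinU_continuous => //; first exact: cD.
  have [[x Cx]|/nonemptyPn ->] := pselect (C n !=set0); last first.
    exact: continuous_subspace0.
  apply: (@subspace_eq_continuous _ _ _ (fun=> F x)); last exact: cst_continuous.
  by move=> y /set_mem Cy; exact: FC Cx Cy.
have FbD n : exists2 M, 0 < M & forall x, D n x -> `|F x| <= M.
  elim: n => [|n [M M0 MD]]; first by exists 1 => // x; rewrite /D big_ord0.
  have [[z Cz]|/nonemptyPn C0] := pselect (C n !=set0); last first.
    by exists M => // x; rewrite /D big_ord_recr /= C0 => -[/MD|].
  exists (M + `|F z|) => [|x]; first by rewrite ltr_pwDl.
  rewrite /D big_ord_recr /= => -[/MD xM|Cx].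
    by rewrite (le_trans xM)// lerDl.
  by rewrite (FC n x z)// lerDr ltW.
have ext n : exists g : K -> R, continuous g /\ forall x, D n x -> g x = F x.
  have [M M0 MD] := FbD n.
  have [g [gF cg _]] := continuous_bounded_extension nK (cD n) M0 (FcD n) MD.
  by exists g; split=> // x Dx; rewrite gF// inE.
have [g gP] := choice ext.
exists g => [n|k]; first exact: (gP n).1.
have [i Ci] := covC k; exists i.+1 => // n /= lt_in.
by apply: (gP n).2; rewrite /D; exact: bigsetU_sup lt_in _ Ci.
Qed.

Lemma B1_discrete_cover {R : realType} {K : topologicalType} (F : K -> R) :
  B1 F -> discrete_subset (range F) ->
  exists C : nat -> set K, [/\ forall n, closed (C n),
    forall n x y, C n x -> C n y -> F x = F y &
    forall x, exists n, C n x].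
Proof.
move=> [f cf fF] dF.
(* The closed ball of centre [q] and radius [r] contains at most one value
   of [F]. *)
pose isol (q : R) r :=
  forall x y, `|F x - q| <= r -> `|F y - q| <= r -> F x = F y.
pose E (i : rat * nat * nat) := let: (q, p, N) := i in
  [set k | isol (ratr q) p.+1%:R^-1 /\
    forall n, (N <= n)%N -> `|f n k - ratr q| <= p.+1%:R^-1].
have cE i : closed (E i).
  case: i => [[q p] N]; rewrite /E.
  have [iq|niq] := pselect (isol (ratr q) p.+1%:R^-1); last first.
    by rewrite (_ : mkset _ = set0); [exact: closed0|rewrite -subset0 => k []].
  rewrite (_ : mkset _ = \bigcap_(n in [set n | (N <= n)%N])
      (f n @^-1` closed_ball_ Num.norm (ratr q : R) p.+1%:R^-1)); last first.
    apply/seteqP; split => k /= => [[_ kE] n /= Nn|kE].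
      by rewrite /closed_ball_ /= distrC kE.
    by split=> // n Nn; rewrite distrC; exact: kE.
  apply: closed_bigI => n _; have /continuous_closedP := cf n; apply.
  exact: closed_closed_ball_.
have FE q p N k : E (q, p, N) k -> `|F k - ratr q| <= p.+1%:R^-1.
  move=> [_ kE]; rewrite distrC.
  have := @closed_closed_ball_ R R^o (ratr q) p.+1%:R^-1.
  move=> /(@closed_cvg _ _ \oo _ (fun n => f n k) _)/(_ _ _ (fF k)); apply.
  by exists N => // n /= Nn; rewrite /closed_ball_ /= distrC kE.
have covE k : exists i, E i k.
  have /existsNP[U /not_implyP[nU noU]] := dF _ (imageT F k).
  have /nbhs_ballP[e /= e0 eU] := nU.
  (* With a radius below [e / 2], any two points of the ball are less than [e]
     apart. *)
  have e20 : 0 < e / 2 by rewrite divr_gt0.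
  have [p _ /(_ p (leqnn p)) /= pe] := near_infty_natSinv_lt (PosNum e20).
  have p0 : 0 < p.+1%:R^-1 :> R by rewrite invr_gt0.
  suff [q [N EqpN]] : exists q N, E (q, p, N) k by exists (q, p, N).
  rewrite /E; move: (p.+1%:R^-1) p0 pe => r r0 re.
  have /rat_in_itvoo[q] : F k - r < F k + r by rewrite ltrD2l gtrN.
  rewrite in_itv /= => /andP[q1 q2].
  have Fkq : `|F k - ratr q| < r by rewrite ltr_distlC q1 q2.
  have near_k y : `|F y - ratr q| <= r -> F y = F k.
    move=> Fyq; apply: contra_notP noU => /eqP nFy; exists (F y); split => //.
    apply: eU; rewrite /ball /= (le_lt_trans (ler_distD (ratr q) _ _))//.
    by rewrite [`|ratr q - _|]distrC; lra.
  have /cvgr_dist_lt := fF k.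
  have gap : 0 < r - `|F k - ratr q| by rewrite subr_gt0.
  move=> /(_ _ gap)[N _ fN]; exists q, N; split.
    by move=> x y Fx Fy; rewrite (near_k x)// (near_k y).
  move=> n /fN /= fn; rewrite (le_trans (ler_distD (F k) _ _))//.
  by rewrite [`|f n k - _|]distrC; lra.
exists (fun n => if unpickle n is Some i then E i else set0); split.
- by move=> n; case: unpickle => [i|]; [exact: cE|exact: closed0].
- move=> n x y; case: unpickle => [[[q p] N]|//] Ex Ey.
  by have [iq _] := Ex; exact: iq (FE _ _ _ _ Ex) (FE _ _ _ _ Ey).
- by move=> x; have [i Ei] := covE x; exists (pickle i); rewrite pickleK.
Qed.

Theorem corollary3p4 (R : realType) (K : topologicalType) (F : K -> R)
    (hK : polish R K) (hF : B1 F) (hd : discrete_subset (range F)) :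
  PS F.
Proof.
have [_ [d [dm nbhsd _]]] := hK.
have [C [cC FC covC]] := B1_discrete_cover F hF hd.
exact: closed_cover_PS F C (metrizable_normal d dm nbhsd) cC FC covC.
Qed.
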